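(* Let $G=\bigoplus_{t=1}^r \mathbb{Z}_{k_t}$ with each $k_t\ge 2$, and write $|G|=\prod_{t=1}^r k_t$. For each $j\in\{1,2,\ldots\}$ let $S_j=\prod_{t=1}^r S_{t,j}\subseteq G$, where each $S_{t,j}$ is a given subset of $\mathbb{Z}_{k_t}=\{0,1,\ldots,k_t-1\}$. For ${\bf s}\in G$ let $c({\bf s};S_1,\ldots,S_m)$ be the number of $m$-tuples $({\bf x}_1,\ldots,{\bf x}_m)$ with ${\bf x}_j\in S_j$ for each $1\le j\le m$ and ${\bf x}_1+\cdots+{\bf x}_m={\bf s}$ in $G$. Assume that for all $1\le t\le r$ and all $j\ge 1$, $$\gcd\{a-b:\ a,b\in S_{t,j}\}=1,$$ where elements of $\mathbb{Z}_{k_t}$ are regarded as integers in $\{0,\ldots,k_t-1\}$. Then there is a constant $0<\theta<1$, independent of $m$, such that as $m\to\infty$, $$c({\bf s};S_1,\ldots,S_m)=\frac{1}{|G|}\Big(\prod_{j=1}^m|S_j|\Big)\big(1+O(\theta^m)\big).$$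
   Context: Addition in $G$ is componentwise, modulo $k_t$ in the $t$-th coordinate. Such a tuple is called an $m$-composition of ${\bf s}$ over $G$ whose $j$-th part lies in $S_j$. *)

(* Defs.v *)
(* MathComp / MathComp-Analysis *)
From mathcomp Require Import all_boot all_order all_algebra all_fingroup.
From mathcomp Require Import all_classical all_reals all_analysis.
Set Implicit Arguments.
Unset Strict Implicit.
Unset Printing Implicit Defensive.
Import Order.TTheory GRing.Theory Num.Theory.
Import numFieldNormedType.Exports.
Local Open Scope ring_scope.

(* The finGroupType structure is the library's finite direct product
   (gproduct), which writes every group law multiplicatively: on 'Z_n the
   product x * y is addition modulo n (see dsumZM).  'Z_n has n elements only
   when 1 < n. *)
Definition dsumZ (r : nat) (k : 'I_r -> nat) : finGroupType :=
  {dffun forall t : 'I_r, 'Z_(k t)}.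

Lemma dsumZM (r : nat) (k : 'I_r -> nat) (x y : dsumZ k) (t : 'I_r) :
  (x * y)%g t = (x t + y t)%R.
Proof. by rewrite ffunE. Qed.

Lemma card_dsumZ (r : nat) (k : 'I_r -> nat) :
  (forall t, (1 < k t)%N) -> #|dsumZ k| = (\prod_(t < r) k t)%N.
Proof.
move=> k_gt1; rewrite card_dep_ffun foldrE big_map -[RHS]big_enum /=.
by rewrite enumT; apply: eq_bigr => t _; rewrite card_ord Zp_cast.
Qed.

Definition boxset (r : nat) (k : 'I_r -> nat)
    (S : forall t : 'I_r, nat -> {set 'Z_(k t)}) (j : nat) : {set dsumZ k} :=
  setXn (fun t => S t j).

(* Part number j < m here is part number j.+1 of the composition, with
   S j its set of admissible values. *)
Definition compositions (gT : finGroupType) (m : nat) (s : gT)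
    (S : 'I_m -> {set gT}) : {set {ffun 'I_m -> gT}} :=
  [set x : {ffun 'I_m -> gT} | [forall j, x j \in S j] && ((\prod_(j < m) x j)%g == s)].

(* The differences are taken in int, on the representatives 0, ..., n-1;
   the gcd of no elements, or of zeros only, is 0. *)
Definition diff_gcd (n : nat) (A : {set 'Z_n}) : nat :=
  \big[gcdn/0%N]_(a in A) \big[gcdn/0%N]_(b in A)
    `|(a : nat)%:Z - (b : nat)%:Z|%N.

(* Main.v *)
(** Normalised by the product of the |S_j|, the number of compositions is the
    law of a random walk on G whose j-th step is uniform on S_j. The gcd
    condition says that the differences of elements of S_j generate G, so
    multiplying a set X by S_j strictly enlarges it unless X = G: otherwise X
    would be stable under all these differences. Hence any N = |G| consecutive
    steps reach every element of G, with probability at least N^-N, and N steps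
    contract the oscillation of the law by a factor 1 - N^-N or better
    (Doeblin's argument). Since the law sums to 1, its distance to 1/N is
    bounded by its oscillation, which decays geometrically. *)
Require Import Defs.
From mathcomp Require Import all_boot all_order all_algebra all_fingroup.
From mathcomp Require Import all_classical all_reals all_analysis.
From mathcomp Require Import ring lra.
Set Implicit Arguments.
Unset Strict Implicit.
Unset Printing Implicit Defensive.
Import Order.TTheory GRing.Theory Num.Theory.
Import numFieldNormedType.Exports.
Local Open Scope classical_set_scope.
Local Open Scope ring_scope.

(** * Growth of product sets in a finite group *)

(** Each translate [X :* a] with [a \in A] lies in [X * A] and has the size of [X], so all of them
    equal [X * A]. Hence right multiplication by any [a * b^-1] fixes [X]; these elements generate
    the group, and a nonempty set fixed by all right translations is everything. *)
Lemma card_mulg_le_setT (gT : finGroupType) (A X : {set gT}) :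
    X != finset.set0 -> A != finset.set0 -> <<A * A^-1>>%g = [set: gT]%SET ->
    (#|(X * A)%g| <= #|X|)%N ->
  X = [set: gT]%SET.
Proof.
move=> /set0Pn[x0 x0X] /set0Pn[a0 a0A] genA leXA.
have cosetE a : a \in A -> (X :* a)%g = (X * A)%g.
  move=> aA; apply/eqP; rewrite eqEcard card_rcoset leXA andbT.
  by rewrite mulgS// finset.sub1set.
have stabX : <<A * A^-1>>%g \subset 'C[X | 'Rs]%g.
  rewrite gen_subG; apply/fintype.subsetP => g /mulsgP[a b aA].
  rewrite mem_invg => bA ->; apply/astab1P => /=.
  rewrite rcosetE rcosetM cosetE// -(cosetE _ bA).
  by rewrite -rcosetM mulVg rcoset1.
apply/setP => y; rewrite [RHS]inE.
have : (x0^-1 * y)%g \in 'C[X | 'Rs]%g.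
  by apply: (fintype.subsetP stabX); rewrite genA inE.
move/astab1P => /=; rewrite rcosetE => <-.
by rewrite mem_rcoset invMg invgK mulKVg.
Qed.

Lemma prod_spanning_setT (gT : finGroupType) (A : nat -> {set gT}) (m : nat) :
    (forall j, A j != finset.set0) ->
    (forall j, <<A j * (A j)^-1>>%g = [set: gT]%SET) ->
  (\prod_(m <= j < m + #|gT|) A j)%g = [set: gT]%SET.
Proof.
move=> A0 genA.
(* The empty product is [{1}], and each further factor adds at least one element until the group is
   full. *)
suff lemin n : (minn #|gT| n.+1 <= #|(\prod_(m <= j < m + n) A j)%g|)%N.
  apply/eqP; rewrite eqEcard finset.subsetT cardsT /=.
  by have := lemin #|gT|; rewrite (minn_idPl _).
elim: n => [|n IHn].
  by rewrite addn0 big_geq// cards1 geq_min orbT.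
rewrite addnS big_nat_recr ?leq_addr//=.
move: IHn; set X := (\prod_(m <= j < m + n) A j)%g => IHn.
have X0 : X != finset.set0.
  rewrite -card_gt0 (leq_trans _ IHn)// leq_min /=.
  by rewrite andbT; apply/card_gt0P; exists 1%g.
have [leXA|] := leqP #|(X * A (m + n)%N)%g| #|X|.
  have XT := card_mulg_le_setT X0 (A0 _) (genA _) leXA.
  have /set0Pn[a aA] := A0 (m + n)%N.
  rewrite geq_min; apply/orP; left; rewrite -cardsT -XT -(card_rcoset X a).
  by rewrite subset_leq_card// mulgS// finset.sub1set.
move=> ltX; rewrite geq_min in IHn; rewrite geq_min.
case/orP: IHn => [/leq_trans->//|leX]; first exact: ltnW.
by rewrite (leq_ltn_trans leX)// orbT.
Qed.

(** Bernoulli's inequality, used to turn a contraction over [#|gT|] steps into a rate per step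
    without extracting a root. *)
Lemma bernoulli_le (R : realDomainType) (x : R) (n : nat) :
  0 <= x <= 1 -> 1 - n%:R * x <= (1 - x) ^+ n.
Proof.
move=> /andP[x0 x1]; elim: n => [|n IHn]; first by rewrite mul0r subr0 expr0.
rewrite exprS (le_trans _ (ler_wpM2l _ IHn)) ?subr_ge0//.
rewrite -natr1; have : 0 <= n%:R * x * x by rewrite !mulr_ge0.
by nra.
Qed.

(** * Contraction of a random walk with varying steps *)

Section RandomWalk.
Variables (R : realType) (gT : finGroupType) (A : nat -> {set gT}).
Hypothesis A_neq0 : forall j, A j != finset.set0.
Hypothesis A_span : forall j, <<A j * (A j)^-1>>%g = [set: gT]%SET.
Variable u : nat -> gT -> R.
(** Conditioning on the last step [a], uniform in [A m]: the walk multiplies on the right, so it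
    came from [s * a^-1]. *)
Hypothesis u_step : forall m s,
  u m.+1 s = #|A m|%:R^-1 * \sum_(a in A m) u m (s * a^-1)%g.

Let cardA_gt0 j : 0 < #|A j|%:R :> R.
Proof. by rewrite ltr0n card_gt0. Qed.

Let mean_const j (c : R) : #|A j|%:R^-1 * \sum_(a in A j) c = c.
Proof.
rewrite sumr_const -[c *+ _]mulr_natl mulrA mulVf ?mul1r//.
by rewrite gt_eqF.
Qed.

Lemma walk_ge (m n : nat) (lo : R) :
  (forall s, lo <= u m s) -> forall s, lo <= u (m + n) s.
Proof.
move=> lou; elim: n => [|n IHn] s; first by rewrite addn0.
rewrite addnS u_step -[leLHS](mean_const (m + n)) ler_wpM2l//.
exact: ler_sum.
Qed.

Lemma walk_le (m n : nat) (hi : R) :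
  (forall s, u m s <= hi) -> forall s, u (m + n) s <= hi.
Proof.
move=> uhi; elim: n => [|n IHn] s; first by rewrite addn0.
rewrite addnS u_step -[leRHS](mean_const (m + n)) ler_wpM2l//.
exact: ler_sum.
Qed.

(** Right translation permutes the group, so averaging translates preserves total mass. *)
Lemma sum_walk (m : nat) : \sum_s u m s = \sum_s u 0 s.
Proof.
elim: m => // m <-; under eq_bigr do rewrite u_step.
rewrite -mulr_sumr exchange_big /=.
under eq_bigr => a _ do rewrite (reindex_inj (mulIg a)) /=.
by under eq_bigr => a _ do under eq_bigr do rewrite mulgK; rewrite mean_const.
Qed.

Lemma walk_ge_reachable (m n : nat) (lo eps : R) (g : gT) :
    (forall s, lo <= u m s) -> 0 <= eps <= #|gT|%:R^-1 ->
  forall s, s \in ([set g]%SET * \prod_(m <= j < m + n) A j)%g ->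
    lo + eps ^+ n * (u m g - lo) <= u (m + n) s.
Proof.
move=> lou /andP[eps0 epsN]; elim: n => [|n IHn] s.
  rewrite addn0 big_geq// mulg1 inE => /eqP ->.
  by rewrite expr0 mul1r addrC subrK.
rewrite addnS big_nat_recr ?leq_addr//= mulgA => /mulsgP[x a xX aA ->].
rewrite u_step (bigD1 a) //= mulgK.
have eps_le : eps <= #|A (m + n)%N|%:R^-1.
  rewrite (le_trans epsN)// lef_pV2 ?posrE// ?ltr0n ?ler_nat ?max_card//.
  by apply/card_gt0P; exists 1%g.
set c : R := #|A (m + n)%N|%:R^-1 in eps_le *.
have : c * (lo + eps ^+ n * (u m g - lo) +
            \sum_(i in A (m + n)%N | i != a) lo) <=
       c * (u (m + n)%N x +
            \sum_(i in A (m + n)%N | i != a) u (m + n)%N (x * a * i^-1)%g).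
  rewrite ler_wpM2l ?invr_ge0//; apply: lerD; first exact: IHn.
  by apply: ler_sum => i _; apply: walk_ge.
apply: le_trans.
(* Returning [lo] to the sum completes a full average of the constant [lo]; what remains is the
   excess carried along the path. *)
have <- : c * (\sum_(i in A (m + n)%N) lo) + c * (eps ^+ n * (u m g - lo)) =
   c * (lo + eps ^+ n * (u m g - lo) + \sum_(i in A (m + n)%N | i != a) lo).
  by rewrite (bigD1 a)//=; ring.
rewrite mean_const exprS -mulrA lerD2l ler_wpM2r//.
by rewrite mulr_ge0 ?exprn_ge0// subr_ge0.
Qed.

(** Every point is reachable from a maximiser [hi0] of [u m] in [#|gT|] steps, so even the smallest
    new value exceeds the old minimum by [eps ^+ #|gT|] times the old oscillation, while the maximum
    has not grown. *)
Lemma walk_contraction (m : nat) (d eps : R) :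
    0 <= eps <= #|gT|%:R^-1 -> (forall x y, u m x - u m y <= d) ->
  forall x y, u (m + #|gT|) x - u (m + #|gT|) y <= (1 - eps ^+ #|gT|) * d.
Proof.
move=> epsP ud x y.
have [lo0 _ lo0P] := @arg_minP _ R gT 1%g predT (u m) isT.
have [hi0 _ hi0P] := @arg_maxP _ R gT 1%g predT (u m) isT.
have ylo : u m lo0 + eps ^+ #|gT| * (u m hi0 - u m lo0) <= u (m + #|gT|) y.
  apply: (@walk_ge_reachable _ _ _ _ hi0) => // [s|]; first exact: lo0P.
  rewrite prod_spanning_setT//; apply/mulsgP.
  by exists hi0 (hi0^-1 * y)%g; rewrite ?inE// mulKVg.
have xhi : u (m + #|gT|) x <= u m hi0 by apply: walk_le => s; exact: hi0P.
have eps1 : eps ^+ #|gT| <= 1.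
  case/andP: epsP => eps0 epsN; rewrite exprn_ile1// (le_trans epsN)//.
  by rewrite invf_le1 ?ler1n ?ltr0n; apply/card_gt0P; exists 1%g.
have := ud hi0 lo0; have : 0 <= 1 - eps ^+ #|gT| by rewrite subr_ge0.
by nra.
Qed.

Lemma walk_osc_geometric :
    (forall s, 0 <= u 0 s <= 1) ->
  exists theta C : R, [/\ 0 < theta < 1, 0 < C &
    forall m x y, u m x - u m y <= C * theta ^+ m].
Proof.
move=> u01; have N0 : (0 < #|gT|)%N by apply/card_gt0P; exists 1%g.
have NR0 : 0 < #|gT|%:R :> R by rewrite ltr0n.
have NR1 : 1 <= #|gT|%:R :> R by rewrite ler1n.
(* The factor 2 keeps [theta] positive when [gT] is trivial. *)
pose eps : R := (2 * #|gT|%:R)^-1.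
have eps0 : 0 < eps by rewrite invr_gt0 mulr_gt0.
have epsN : eps <= #|gT|%:R^-1 by rewrite lef_pV2 ?posrE ?mulr_gt0//; lra.
have eps1 : eps < 1 by rewrite invf_lt1 ?mulr_gt0//; lra.
pose delta := eps ^+ #|gT|.
have delta0 : 0 < delta by rewrite exprn_gt0.
have delta1 : delta < 1 by rewrite exprn_ilt1 ?ltW// -lt0n.
have dN : delta / #|gT|%:R <= delta.
  by rewrite ler_pdivrMr// ler_peMr// ltW.
have dN0 : 0 < delta / #|gT|%:R by rewrite divr_gt0.
(* Chosen so that Bernoulli's inequality gives [theta ^+ #|gT| >= 1 - delta], the contraction factor
   over [#|gT|] steps. *)
pose theta := 1 - delta / #|gT|%:R.
have theta0 : 0 < theta by rewrite /theta; lra.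
have theta1 : theta < 1 by rewrite /theta; lra.
have thetaN : 1 - delta <= theta ^+ #|gT|.
  have := @bernoulli_le R (delta / #|gT|%:R) #|gT|.
  by rewrite [_%:R * _]mulrC divfK ?gt_eqF//; apply; apply/andP; split; lra.
have C0 : 0 < theta ^- #|gT| by rewrite invr_gt0 exprn_gt0.
(* With this constant the bound is at least 1 for [m < #|gT|], where the oscillation is at most 1;
   larger [m] follow by induction in strides of [#|gT|]. *)
exists theta, (theta ^- #|gT|); split=> //; first exact/andP.
elim/ltn_ind => m IHm x y; have [ltm|lem] := ltnP m #|gT|.
  rewrite (@le_trans _ _ 1)//.
    have uge : 0 <= u (0 + m)%N y by apply: walk_ge => s; case/andP: (u01 s).
    have ule : u (0 + m)%N x <= 1 by apply: walk_le => s; case/andP: (u01 s).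
    by rewrite !add0n in uge ule; lra.
  rewrite mulrC ler_pdivlMr ?exprn_gt0// mul1r.
  by rewrite ler_wiXn2l ?(ltnW ltm)// ltW.
rewrite -(subnK lem).
have /IHm ud : (m - #|gT| < m)%N by rewrite ltn_subrL N0 (leq_trans N0 lem).
apply: le_trans (walk_contraction (eps := eps) _ ud x y) _; first by rewrite ltW.
rewrite [leLHS]mulrC exprD mulrA ler_wpM2l//.
by rewrite mulr_ge0 ?exprn_ge0// ltW.
Qed.

End RandomWalk.

(** * From the gcd condition to generation *)

(** Bezout in natural numbers, [km * m = kn * n + gcdn m n], which is stated for positive [m]. *)
Lemma mem_expg_gcdn (gT : finGroupType) (H : {group gT}) (x : gT) (m n : nat) :
  (x ^+ m \in H -> x ^+ n \in H -> x ^+ gcdn m n \in H)%g.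
Proof.
case: m => [|m]; first by rewrite gcd0n.
move=> xm xn; have [km kn def_gcd _] := @egcdnP m.+1 n isT.
have : (x ^+ (km * m.+1) \in H)%g by rewrite mulnC expgM groupX.
by rewrite def_gcd expgD groupMl// mulnC expgM groupX.
Qed.

(** The exponents [d] with [g ^+ d] in [H] contain all the differences and are closed under gcd,
    hence contain 1; and [g], the residue 1, generates ['Z_n]. *)
Lemma diff_gcd_span (n : nat) (A : {set 'Z_n}) :
  diff_gcd A = 1%N -> <<A * A^-1>>%g = [set: 'Z_n]%SET.
Proof.
move=> gcdA; set H := <<A * A^-1>>%G; pose g : 'Z_n := 1%R.
have diffE (a b : 'Z_n) : (b <= a)%N ->
    (g ^+ (a - b)%N)%g = (a * b^-1)%g.
  move=> leba; rewrite FinRing.zmodXgE FinRing.zmodMgE FinRing.zmodVgE.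
  by rewrite mulrnBr// !natr_Zp.
have memH (a b : 'Z_n) : a \in A -> b \in A -> (a * b^-1)%g \in H.
  by move=> aA bA; rewrite mem_gen// mem_mulg// mem_invg invgK.
have mem1 : (g ^+ 1)%g \in H.
  rewrite -[1%N in X in X \in _]gcdA /diff_gcd.
  apply: (big_ind (fun d => (g ^+ d)%g \in H)) => [|d e|a aA].
  - by rewrite expg0.
  - exact: mem_expg_gcdn.
  apply: (big_ind (fun d => (g ^+ d)%g \in H)) => [|d e|b bA].
  - by rewrite expg0.
  - exact: mem_expg_gcdn.
  have [leba|/ltnW leab] := leqP b a.
    by rewrite distnEl// diffE// memH.
  by rewrite distnEr// diffE// memH.
apply/setP => z; rewrite [RHS]inE -[z]natr_Zp -FinRing.zmodXgE.
by rewrite -[1%R]/g -[g]expg1 groupX.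
Qed.

Lemma diff_gcd_neq0 (n : nat) (A : {set 'Z_n}) :
  diff_gcd A = 1%N -> A != finset.set0.
Proof. by apply: contra_eqN => /eqP->; rewrite /diff_gcd finset.big_set0. Qed.

Lemma boxset_neq0 (r : nat) (k : 'I_r -> nat)
    (S : forall t : 'I_r, nat -> {set 'Z_(k t)}) (j : nat) :
  (forall t, diff_gcd (S t j) = 1%N) -> boxset S j != finset.set0.
Proof.
move=> gcdS.
have /fin_all_exists[a aS] t : exists a, a \in S t j.
  exact/set0Pn/diff_gcd_neq0.
apply/set0Pn; exists (finfun a : dsumZ k); rewrite in_setXn.
by apply/forallP => t; rewrite ffunE; exact: aS.
Qed.

(** Since [1 \in D t], the box of the [D t] contains a copy of each [D t] on its own axis, where it
    generates the whole factor; the axes generate the product. *)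
Lemma boxset_span (r : nat) (k : 'I_r -> nat)
    (S : forall t : 'I_r, nat -> {set 'Z_(k t)}) (j : nat) :
    (forall t, diff_gcd (S t j) = 1%N) ->
  <<boxset S j * (boxset S j)^-1>>%g = [set: dsumZ k]%SET.
Proof.
move=> gcdS; pose D (t : 'I_r) : {set 'Z_(k t)} := (S t j * (S t j)^-1)%g.
have D1 t : 1%g \in D t.
  have /set0Pn[a aS] := diff_gcd_neq0 (gcdS t).
  by apply/mulsgP; exists a a^-1%g; rewrite ?mem_invg ?invgK ?mulgV.
have spanD : [set: dsumZ k]%SET \subset <<setXn D>>%g.
  have -> : [set: dsumZ k]%SET =
      setXn (fun t => [set: 'Z_(k t)]%G).
    apply/setP => x; rewrite in_setXn inE.
    by apply/esym/forallP => t; rewrite inE.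
  rewrite -setXn_prod prod_subG// => t _ /=.
  rewrite -(diff_gcd_span (gcdS t)) -morphim_dfung1 morphim_gen ?finset.subsetT//.
  rewrite morphim_dfung1 genS// set1gXnE setXnS// => t'.
  have [<-|neq_t] := eqVneq t t'; first by rewrite dfwith_in.
  rewrite dfwith_out//; apply/fintype.subsetP => x /finset.set1P ->.
  exact: D1.
apply/eqP; rewrite finset.eqEsubset finset.subsetT.
rewrite (fintype.subset_trans spanD)// genS//.
apply/fintype.subsetP => x; rewrite in_setXn => /forallP xD.
(* Choosing the two terms coordinate by coordinate writes an element of the box of differences as a
   difference of two elements of the box. *)
have /fin_all_exists[ab abP] t : exists ab : 'Z_(k t) * 'Z_(k t),
    [/\ ab.1 \in S t j, ab.2 \in S t j & x t = (ab.1 * ab.2^-1)%g].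
  case/mulsgP: (xD t) => a b aS; rewrite mem_invg => bS ->.
  by exists (a, b^-1%g); rewrite /= invgK.
pose a : dsumZ k := [ffun t => (ab t).1].
pose b : dsumZ k := [ffun t => (ab t).2].
apply/mulsgP; exists a b^-1%g.
- by rewrite in_setXn; apply/forallP => t; rewrite ffunE; case: (abP t).
- rewrite mem_invg invgK in_setXn; apply/forallP => t.
  by rewrite ffunE; case: (abP t).
- by apply/ffunP => t; rewrite !ffunE; case: (abP t).
Qed.

(** * Counting compositions and the asymptotics *)

(** Sort by the last part [a]: deleting it is a bijection onto the compositions of [s * a^-1].
    Taking the last part lets [a] cancel on the right without commutativity. *)
Lemma card_compositions_recr (gT : finGroupType) (m : nat) (s : gT)
    (B : nat -> {set gT}) :
  #|compositions s (fun j : 'I_m.+1 => B j)| =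
    (\sum_(a in B m) #|compositions (s * a^-1)%g (fun j : 'I_m => B j)|)%N.
Proof.
rewrite -sum1_card (partition_big (fun x : {ffun 'I_m.+1 -> gT} => x ord_max)
  (mem (B m))) /= => [|x]; last first.
  by rewrite inE => /andP[/forallP/(_ ord_max)].
apply: eq_bigr => a aB; rewrite -sum1_card.
pose ext (y : {ffun 'I_m -> gT}) : {ffun 'I_m.+1 -> gT} :=
  [ffun i => oapp y a (unlift ord_max i)].
pose res (x : {ffun 'I_m.+1 -> gT}) : {ffun 'I_m -> gT} :=
  [ffun i => x (lift ord_max i)].
rewrite (reindex_onto ext res) => [|x /andP[_ /eqP xa]]; last first.
  by apply/ffunP => i; rewrite ffunE; case: unliftP => [i'|] -> //=; rewrite ffunE.
apply: eq_bigl => y.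
have ext_max : ext y ord_max = a by rewrite ffunE unlift_none.
have ext_lift i : ext y (lift ord_max i) = y i by rewrite ffunE liftK.
have -> : res (ext y) = y by apply/ffunP => i; rewrite ffunE.
rewrite ext_max !eqxx !andbT !inE; congr (_ && _).
  apply/forallP/forallP => yB i.
    by have := yB (lift ord_max i); rewrite ext_lift lift_max.
  by case: (unliftP ord_max i) => [i'|] ->; rewrite ?ext_max// ext_lift lift_max.
rewrite big_ord_recr /= ext_max.
under eq_bigr => i _.
  rewrite (_ : widen_ord _ i = lift ord_max i); last first.
    by apply: val_inj; exact/esym/lift_max.
  rewrite ext_lift; over.
by apply/eqP/eqP => [<-|->]; rewrite ?mulgK ?mulgKV.
Qed.

Lemma card_compositions0 (gT : finGroupType) (s : gT) (B : 'I_0 -> {set gT}) :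
  #|compositions s B| = (s == 1%g).
Proof.
have [->|/negbTE s1] := eqVneq s 1%g.
  rewrite eq_cardT => [|x]; first by rewrite -cardT card_ffun card_ord.
  by rewrite !inE big_ord0 eqxx andbT; apply/forallP => -[].
by rewrite eq_card0// => x; rewrite !inE big_ord0 eq_sym s1 andbF.
Qed.

Theorem theorem1 (R : realType) (r : nat) (k : 'I_r -> nat)
    (hk : forall t : 'I_r, (2 <= k t)%N)
    (S : forall t : 'I_r, nat -> {set 'Z_(k t)})
    (hS : forall (t : 'I_r) (j : nat), (1 <= j)%N -> diff_gcd (S t j) = 1%N) :
  exists theta : R, 0 < theta < 1 /\
    forall s : dsumZ k, exists e : nat -> R,
      e =O_\oo (fun m : nat => theta ^+ m) /\
      forall m : nat,
        #|compositions s (fun j : 'I_m => boxset S j.+1)|%:R =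
          (#|dsumZ k|%:R)^-1 * (\prod_(1 <= j < m.+1) #|boxset S j|%:R)
            * (1 + e m).
Proof.
(* The shift makes the gcd hypothesis, given for indices from 1 on, available at every [j]. *)
pose B j := boxset S j.+1.
have B_span j : <<B j * (B j)^-1>>%g = [set: dsumZ k]%SET.
  by apply: boxset_span => t; exact: hS.
have B_neq0 j : B j != finset.set0.
  by apply: boxset_neq0 => t; exact: hS.
have B_gt0 j : 0 < #|B j|%:R :> R by rewrite ltr0n card_gt0.
pose P m : R := \prod_(j < m) #|B j|%:R.
have P_gt0 m : 0 < P m by apply: prodr_gt0.
pose u m (s : dsumZ k) : R :=
  #|compositions s (fun j : 'I_m => B j)|%:R / P m.
have u0 s : u 0 s = (s == 1%g)%:R.
  by rewrite /u /P big_ord0 divr1 card_compositions0.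
have u_step m s : u m.+1 s = #|B m|%:R^-1 * \sum_(a in B m) u m (s * a^-1)%g.
  rewrite /u card_compositions_recr natr_sum /P big_ord_recr/= invfM.
  by rewrite -mulr_suml [in LHS]mulrC -mulrA [in LHS]mulrCA
    [_^-1 * \sum_(_ in _) _]mulrC.
have N_gt0 : 0 < #|dsumZ k|%:R :> R.
  by rewrite ltr0n; apply/card_gt0P; exists 1%g.
have sum_u m : \sum_s u m s = 1.
  rewrite (sum_walk B_neq0 u_step) (bigD1 1%g)//= u0 eqxx big1 ?addr0// => s s1.
  by rewrite u0 (negbTE s1).
have [theta [C [theta01 C_gt0 oscP]]] :
    exists theta C : R, [/\ 0 < theta < 1, 0 < C &
      forall m x y, u m x - u m y <= C * theta ^+ m].
  apply: (walk_osc_geometric B_neq0 B_span u_step) => s.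
  by rewrite u0; case: (s == 1%g); rewrite ?lexx ?ler01.
(* The error term is obtained by solving the claimed identity for [e m]; [theta] is fixed before
   [s]. *)
exists theta; split=> // s; exists (fun m => #|dsumZ k|%:R * u m s - 1); split.
  apply/eqO_exP; exists (#|dsumZ k|%:R * C); first exact: mulr_gt0.
  near=> m.
  have theta_ge0 : 0 <= theta ^+ m.
    by rewrite exprn_ge0// ltW//; case/andP: theta01.
  (* As the law has total mass 1, the error is a sum of [#|dsumZ k|] differences of values, each
     bounded by the oscillation. *)
  have -> : #|dsumZ k|%:R * u m s - 1 = \sum_(y : dsumZ k) (u m s - u m y).
    by rewrite sumrB sum_u sumr_const mulr_natl.
  rewrite (le_trans (ler_norm_sum _ _ _))// (ger0_norm theta_ge0).
  rewrite -mulrA [leRHS]mulr_natl -sumr_const; apply: ler_sum => y _.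
  by rewrite ler_norml oscP lerNl opprB oscP.
move=> m; rewrite big_add1 big_mkord -/(P m) addrC subrK.
rewrite mulrACA mulVf ?gt_eqF// mul1r mulrC /u divfK// gt_eqF//.
Unshelve. all: by end_near.
Qed.
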